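(* Let $d,D\in\mathbb{Z}_{>0}$ with $D$ squarefree. If $(d,D)\neq(1,1)$, then $$\mathcal{GP}_{(1,1,1,d)}(\mathbb{Q}(\sqrt{-D}))=\mathcal{GP}_{(1,1,1,d)}(\mathbb{Q})=\begin{cases}\{(\pm 3,3,\pm 3)\} & \text{if } d=1,\\ \{(\pm 1,1,\pm 1)\} & \text{if } d=3,\\ \emptyset & \text{if } d\neq 1,3,\end{cases}$$ and $\mathcal{GP}_{(1,1,1,1)}(\mathbb{Q}(i))=\{(\pm 3,3,\pm 3),(\pm i,-1,\mp i)\}$.
   Context: For a number field $K$ with ring of integers $\mathcal{O}_K$ and $a,b,c,d\in\mathcal{O}_K$, $\mathcal{GP}_{(a,b,c,d)}(K)$ denotes the set of non-trivial triples $(x,y,z)\in\mathcal{O}_K^3$ in geometric progression satisfying $ax^2+by^2+cz^2=dxyz$. Here $(x,y,z)$ is in geometric progression over $\mathcal{O}_K$ if there exist $\alpha,\beta\in\mathcal{O}_K$ with $x=\alpha$, $y=\alpha\beta$, $z=\alpha\beta^2$; it is non-trivial if $\alpha\neq 0$ (i.e. $(x,y,z)\neq(0,0,0)$). Signs are correlated: $(\pm r,s,\pm t)$ stands for the two triples $(r,s,t)$ and $(-r,s,-t)$, and $(\pm i,-1,\mp i)$ stands for the two triples $(i,-1,-i)$ and $(-i,-1,i)$. *)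

(* Defs.v *)
From mathcomp Require Import all_boot all_order all_algebra all_field.
From mathcomp Require Import classical_sets.

Set Implicit Arguments.
Unset Strict Implicit.
Unset Printing Implicit Defensive.

Import GRing.Theory Num.Theory.

Local Open Scope classical_set_scope.
Local Open Scope ring_scope.

Definition squarefree (n : nat) : Prop :=
  forall m : nat, (m ^ 2 %| n)%N -> m = 1%N.

(* Number fields are realized as subfields of algC, so that the solution sets
   over different number fields can be compared inside algC ^ 3. *)

Definition Q : set algC := [set x | x \in Crat].

(* The smallest subfield containing A; divring_closed is closure under 1, x - y
   and x / y, which for a subset of a field (where x / 0 = 0) amounts to being
   a subfield. *)
Definition Qadjoin (A : set algC) : set algC :=
  [set x | forall S : {pred algC},
             divring_closed S -> (forall a, A a -> a \in S) -> x \in S].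

Definition Qsqrt_opp (D : nat) : set algC := Qadjoin [set sqrtC (- D%:R)].

Definition ring_of_integers (K : set algC) : set algC :=
  [set x | K x /\ x \in Aint].

Definition geometric_progression (K : set algC) (x y z : algC) : Prop :=
  exists alpha beta : algC,
    [/\ ring_of_integers K alpha, ring_of_integers K beta,
        x = alpha, y = alpha * beta & z = alpha * beta ^+ 2].

Definition GP (K : set algC) (a b c d : algC) : set (algC * algC * algC) :=
  [set t | let: (x, y, z) := t in
    [/\ [/\ ring_of_integers K x, ring_of_integers K y & ring_of_integers K z],
        geometric_progression K x y z,
        (x, y, z) <> (0, 0, 0) &
        a * x ^+ 2 + b * y ^+ 2 + c * z ^+ 2 = d * x * y * z]].

(* Main.v *)
From HB Require Import structures.
Require Import Defs.
From mathcomp Require Import all_boot all_order all_algebra all_field.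
From mathcomp Require Import classical_sets.
From mathcomp Require Import ring.

Set Implicit Arguments.
Unset Strict Implicit.
Unset Printing Implicit Defensive.

Import GRing.Theory Num.Theory.

Local Open Scope classical_set_scope.
Local Open Scope ring_scope.

(** Writing a progression as [(al, al * be, al * be ^+ 2)] with [al != 0],
    the equation becomes [1 + be ^+ 2 + be ^+ 4 = d * al * be ^+ 3], so that
    [be] divides 1 in the ring of integers: it is a unit ([GP_imquad]).

    An imaginary quadratic field has very few units ([imquad_unit_cases]).
    If [u] is one, then its norm [u * u^*] is a positive rational algebraic
    integer whose inverse is one too, hence it is 1; and its trace
    [t = u + u^*] is an integer with [t ^+ 2 <= 4], since
    [4 - t ^+ 2 = 4 * u * u^* - t ^+ 2 = `|u - u^*| ^+ 2].  As [u] is a root of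
    ['X^2 - t 'X + 1], it is [1] or [-1] when [`|t| = 2], a square root of [-1]
    when [t = 0], and a primitive cube root of unity up to sign when
    [`|t| = 1].  In the last case [1 + u ^+ 2 + u ^+ 4 = 0], which is impossible
    for [be].  The case [be = 1] or [be = -1] gives [d * al = 3 * be], hence
    the rational solutions.  If [be ^+ 2 = -1], then [d * (- (al * be)) = 1]
    forces [d = 1] and [al = be]; moreover a field Q(sqrt(-D)) with [D]
    squarefree contains a square root of [-1] only for [D = 1]
    ([sqrtN1_Qsqrt_opp]). *)

(** * Imaginary quadratic fields inside the algebraic numbers *)

Lemma Crat_half_div_sqr (w r s : algC) : w ^+ 2 \in Crat ->
  r \in Crat -> s \in Crat -> (r + s / w ^+ 2) / 2 \in Crat.
Proof. by move=> w2 Hr Hs; rewrite rpred_div ?rpredD ?rpred_div ?rpred_nat. Qed.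

(** The field Q(w) for [w] nonzero, imaginary, of rational square.  An element
    [r + s * w] with [r] and [s] rational has trace [2 * r], and
    [w * (x - x^* ) = 2 * s * w ^+ 2]; rationality of these two numbers is a
    boolean description of the field that avoids choosing [r] and [s]. *)
Definition imquad_pred (w : algC) : {pred algC} :=
  fun x => (x + x^* \in Crat) && ((x - x^*) * w \in Crat).

Lemma imquad_pred_norm (w y : algC) : w != 0 -> w ^+ 2 \in Crat ->
  y \in imquad_pred w -> y * y^* \in Crat.
Proof.
move=> w0 w2 /andP[y1 y2].
have -> : y * y^* =
    ((y + y^*) ^+ 2 / 2 + (- (((y - y^*) * w) ^+ 2 / 2)) / w ^+ 2) / 2.
  by field.
by rewrite Crat_half_div_sqr // ?rpredN rpred_div ?rpred_nat // rpredX.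
Qed.

Lemma imquad_pred_closed (w : algC) : w != 0 -> w ^+ 2 \in Crat ->
  w^* = - w -> divring_closed (imquad_pred w).
Proof.
move=> w0 w2 wc; split.
- by rewrite unfold_in rmorph1 subrr mul0r rpredD ?rpred1 ?rpred0.
- move=> x y /andP[x1 x2] /andP[y1 y2]; rewrite unfold_in rmorphB /=.
  have -> : x - y + (x^* - y^*) = (x + x^*) - (y + y^*) by ring.
  have -> : (x - y - (x^* - y^*)) * w = (x - x^*) * w - (y - y^*) * w by ring.
  by rewrite !rpredB.
move=> x y Sx Sy; have Ny := imquad_pred_norm w0 w2 Sy.
have [->|y0] := eqVneq y 0.
  by rewrite invr0 mulr0 unfold_in rmorph0 subrr mul0r addr0 rpred0.
have yc0 : y^* != 0 by rewrite fmorph_eq0.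
move: Sx Sy => /andP[x1 x2] /andP[y1 y2].
rewrite unfold_in rmorphM fmorphV /=.
have -> : x / y + x^* / y^* = ((x + x^*) * (y + y^*) +
    (- (((x - x^*) * w) * ((y - y^*) * w))) / w ^+ 2) / 2 / (y * y^*).
  by field; rewrite w0 y0 yc0.
have -> : (x / y - x^* / y^*) * w = ((x - x^*) * w * (y + y^*) -
    (x + x^*) * ((y - y^*) * w)) / 2 / (y * y^*).
  by field; rewrite y0 yc0.
apply/andP; split.
  by rewrite rpred_div // Crat_half_div_sqr // ?rpredN rpredM.
by rewrite rpred_div // rpred_div ?rpred_nat // rpredB // rpredM.
Qed.

Lemma Qadjoin_imquad (w x : algC) : w != 0 -> w ^+ 2 \in Crat -> w^* = - w ->
  Qadjoin [set w] x -> x \in imquad_pred w.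
Proof.
move=> w0 w2 wc; apply; first exact: imquad_pred_closed.
move=> _ ->; rewrite unfold_in wc subrr rpred0 opprK mulrDl -expr2.
by rewrite rpredD.
Qed.

Lemma subQ_Qadjoin (A : set algC) : Q `<=` Qadjoin A.
Proof.
move=> x Qx S Scl _.
pose Sm := GRing.isDivringClosed.Build _ S Scl.
pose S' : divringClosed algC := HB.pack S Sm.
exact: (rpred_Crat S').
Qed.

Lemma mem_Qadjoin (A : set algC) : A `<=` Qadjoin A.
Proof. by move=> x Ax S _; apply. Qed.

Lemma QadjoinN (A : set algC) (x : algC) : Qadjoin A x -> Qadjoin A (- x).
Proof.
move=> Kx S Scl SA; have [S1 SB _] := Scl.
by rewrite -sub0r -(subrr 1); apply: (SB); [apply: (SB)|apply: Kx].
Qed.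

(** * Units of imaginary quadratic fields *)

(** The three cases are those of trace [2] or [-2], [0], and [1] or [-1];
    the last one covers the primitive third and sixth roots of unity. *)
Lemma imquad_unit_cases (w u : algC) : w != 0 -> w ^+ 2 \in Crat -> w^* = - w ->
  Qadjoin [set w] u -> u \in Aint -> u^-1 \in Aint -> u != 0 ->
  [\/ u ^+ 2 = 1, u ^+ 2 = -1 | 1 + u ^+ 2 + u ^+ 4 = 0].
Proof.
move=> w0 w2 wc Ku Iu Iv u0; have Su := Qadjoin_imquad w0 w2 wc Ku.
have Nu := imquad_pred_norm w0 w2 Su.
have uc0 : u^* != 0 by rewrite fmorph_eq0.
have N1 : u * u^* = 1.
  have Icu : u * u^* \in Aint by rewrite rpredM // Aint_aut.
  have Icv : (u * u^*)^-1 \in Aint.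
    by rewrite invfM rpredM // -fmorphV Aint_aut.
  have := Cint_rat_Aint Nu Icu; have := Cint_rat_Aint (rpredVr Nu) Icv.
  have Ngt0 : 0 < u * u^* by rewrite mul_conjC_gt0.
  move: (u * u^*) Ngt0 => N Ngt0 Zv ZN.
  have ge1 (x : algC) : 0 < x -> x \is a Num.int -> 1 <= x.
    by move=> x0 Zx; have := norm_intr_ge1 Zx (lt0r_neq0 x0); rewrite gtr0_norm.
  apply/Order.POrderTheory.le_anti; rewrite ge1 // andbT.
  by rewrite -[N]invrK invf_le1 ?ge1 ?invr_gt0.
have /andP[Tu _] := Su.
have : u + u^* \is a Num.int by rewrite Cint_rat_Aint // rpredD // Aint_aut.
case/intrP=> t et.
have qu : u ^+ 2 = t%:~R * u - 1 by rewrite -et -N1; ring.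
(* The discriminant [t ^+ 2 - 4] equals [- `|u - u^*| ^+ 2]. *)
have t4 : t ^+ 2 <= 4.
  have : 0 <= (u - u^*) * (u - u^*)^* by rewrite mul_conjC_ge0.
  rewrite rmorphB /= conjCK.
  have -> : (u - u^*) * (u^* - u) = 4 * (u * u^*) - (u + u^*) ^+ 2 by ring.
  rewrite N1 et subr_ge0 mulr1 => h.
  by rewrite -(ler_int algC) rmorphXn.
have qu4 : 1 + u ^+ 2 + u ^+ 4 = (u ^+ 2 + 1 + u) * (u ^+ 2 + 1 - u) by ring.
have {t4} : (`|t| <= 2)%N.
  by rewrite -(@leq_exp2r _ _ 2) // -abszX -lez_nat gez0_abs ?sqr_ge0.
case: t et qu => [[|[|[|n]]]|[|[|n]]] et qu // _.
- by constructor 2; rewrite qu mul0r sub0r.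
- by constructor 3; rewrite qu4 qu; ring.
- constructor 1; have /eqP : (u - 1) ^+ 2 = 0 by rewrite sqrrB1 qu; ring.
  by rewrite sqrf_eq0 subr_eq0 => /eqP ->; rewrite expr1n.
- by constructor 3; rewrite qu4 qu NegzE; ring.
- constructor 1; have /eqP : (u + 1) ^+ 2 = 0 by rewrite sqrrD1 qu NegzE; ring.
  by rewrite sqrf_eq0 addr_eq0 => /eqP ->; rewrite sqrrN expr1n.
Qed.

Lemma sqrtC_opp (D : nat) : (0 < D)%N ->
  let w := sqrtC (- D%:R) : algC in
  [/\ w != 0, w ^+ 2 = - D%:R & w^* = - w].
Proof.
move=> D0 w; have w2 : w ^+ 2 = - D%:R by rewrite sqrtCK.
have w0 : w != 0 by rewrite -sqrf_eq0 w2 oppr_eq0 pnatr_eq0 -lt0n.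
split=> //.
have : (w^*) ^+ 2 = w ^+ 2 by rewrite -rmorphXn /= w2 rmorphN /= conjC_nat.
move/eqP; rewrite eqf_sqr => /orP[/eqP wc|/eqP //].
have : 0 < w ^+ 2 by rewrite expr2 -{2}wc mul_conjC_gt0.
by rewrite w2 oppr_gt0 ltrn0.
Qed.

(** If [x ^+ 2 = -1] and [w ^+ 2 = - D], then [x * w] is a rational square root
    of [D], hence an integer. *)
Lemma sqrtN1_Qsqrt_opp (D : nat) (x : algC) : (0 < D)%N -> squarefree D ->
  Qsqrt_opp D x -> x ^+ 2 = -1 -> D = 1%N.
Proof.
move=> D0 sD Kx x2; have [w0 w2 wc] := sqrtC_opp D0.
have w2Q : sqrtC (- D%:R) ^+ 2 \in Crat by rewrite w2 rpredN rpred_nat.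
have /andP[_] := Qadjoin_imquad w0 w2Q wc Kx.
move: (sqrtC _) w2 {w0 wc w2Q Kx} => w w2.
have -> : x^* = - x.
  have /eqP : x ^+ 2 = 'i ^+ 2 by rewrite sqrCi.
  by rewrite eqf_sqr => /orP[]/eqP->; rewrite ?rmorphN /= conjCi.
rewrite opprK => xwQ.
have {}xwQ : x * w \in Crat.
  have -> : x * w = (x + x) * w / 2 by field.
  by rewrite rpred_div ?rpred_nat.
have xw2 : (x * w) ^+ 2 = D%:R by rewrite exprMn x2 w2 mulrNN mul1r.
have xwI : x * w \in Aint.
  apply: (@root_monic_Aint ('X^2 - D%:R%:P)).
  - by rewrite rootE !hornerE xw2 subrr.
  - by rewrite monicXnsubC.
  - by rewrite polyOverXnsubC rpred_nat.
have /intrP[n en] := Cint_rat_Aint xwQ xwI.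
have nD : (`|n| ^ 2)%N = D.
  rewrite -abszX; apply/eqP; rewrite -(eqr_nat algC) -xw2 en -rmorphXn /=.
  by rewrite natr_absz ger0_norm ?sqr_ge0.
have /sD n1 : (`|n| ^ 2 %| D)%N by rewrite nD.
by rewrite -nD n1.
Qed.

(** * Solutions in geometric progression *)

Lemma GP_mono (K L : set algC) (a b c d : algC) :
  K `<=` L -> GP K a b c d `<=` GP L a b c d.
Proof.
move=> KL; have OKL x : ring_of_integers K x -> ring_of_integers L x.
  by case=> /KL.
move=> [[x y] z] [[Ox Oy Oz] [al [be [Oal Obe ex ey ez]]] n0 e].
split=> //; first by split; apply: OKL.
by exists al, be; split=> //; apply: OKL.
Qed.

(** The progressions of ratio [1] or [-1] that solve the equation. *)
Definition rational_solutions (d : nat) : set (algC * algC * algC) :=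
  if d == 1%N then [set (3, 3, 3); (-3, 3, -3)]
  else if d == 3%N then [set (1, 1, 1); (-1, 1, -1)]
  else set0.

Lemma rational_solutions_subQ (d : nat) :
  rational_solutions d `<=` GP Q 1 1 1 d%:R.
Proof.
have OQ (m : int) : ring_of_integers Q m%:~R by split; apply: rpred_int.
(* An integer progression of ratio [e = 1] or [e = -1] and first term [m]. *)
have GPz (m e : int) : e ^+ 2 = 1 -> m != 0 -> d%:Z * m = 3 * e ->
    GP Q 1 1 1 d%:R (m%:~R, (m * e)%:~R, m%:~R).
  move=> e2 m0 dm; have eC : e%:~R ^+ 2 = 1 :> algC by rewrite -rmorphXn /= e2.
  have dC : d%:R * m%:~R = 3 * e%:~R :> algC.
    by have /(congr1 (intr : int -> algC)) := dm; rewrite !rmorphM.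
  split=> //.
  - exists m%:~R, e%:~R; split=> //; first by rewrite rmorphM.
    by rewrite eC mulr1.
  - by case=> /eqP; rewrite intr_eq0 (negPf m0).
  rewrite rmorphM /= dC exprMn eC.
  have -> : 3 * e%:~R * (m%:~R * e%:~R) * m%:~R =
    3 * e%:~R ^+ 2 * m%:~R ^+ 2 :> algC by ring.
  by rewrite eC; ring.
have H1 := GPz 3 1; have H2 := GPz (-3) (-1).
have H3 := GPz 1 1; have H4 := GPz (-1) (-1).
rewrite /rational_solutions.
case: eqP => [d1|_]; last case: eqP => [d3|_ //].
  by move=> _ [] ->; [apply: H1|apply: H2]; rewrite ?d1.
by move=> _ [] ->; [apply: H3|apply: H4]; rewrite ?d3.
Qed.

Lemma GP_sqrtN1 (A : set algC) (u : algC) : Qadjoin A u -> u ^+ 2 = -1 ->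
  GP (Qadjoin A) 1 1 1 1 (u, -1, - u).
Proof.
move=> Ku u2.
have Ou : ring_of_integers (Qadjoin A) u.
  split=> //; apply: (@Aint_unity_root 4); rewrite // unity_rootE.
  by rewrite -[4%N]/(2 * 2)%N exprM u2 sqrrN expr1n.
have ON1 : ring_of_integers (Qadjoin A) (-1).
  by split; [apply: subQ_Qadjoin; rewrite /Q /= rpredN rpred1
            | rewrite rpredN rpred1].
have ONu : ring_of_integers (Qadjoin A) (- u).
  by split; [apply: QadjoinN | rewrite rpredN; case: Ou].
split=> //.
- by exists u, u; split; rewrite // -?expr2 // u2 mulrN1.
- by case=> _ /eqP; rewrite oppr_eq0 oner_eq0.
by rewrite !sqrrN u2 expr1n !mul1r mulrN1 mulrNN -expr2 u2 addNr add0r.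
Qed.

(** The right-hand alternative is the progression of first term and ratio [x],
    a square root of [-1]. *)
Lemma GP_imquad (w : algC) (d : nat) (x y z : algC) :
  w != 0 -> w ^+ 2 \in Crat -> w^* = - w -> (0 < d)%N ->
  GP (Qadjoin [set w]) 1 1 1 d%:R (x, y, z) ->
  rational_solutions d (x, y, z) \/
  [/\ d = 1%N, Qadjoin [set w] x, x ^+ 2 = -1, y = -1 & z = - x].
Proof.
move=> w0 w2 wc d0 [_ [al [be [[_ Ial] [Kbe Ibe] -> -> ->]]] n0 e].
have al0 : al != 0 by apply/eqP=> al0; apply: n0; rewrite al0 !mul0r.
have dC0 : d%:R != 0 :> algC by rewrite pnatr_eq0 -lt0n.
have {}e : 1 + be ^+ 2 + be ^+ 4 = d%:R * al * be ^+ 3.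
  have al2 : al ^+ 2 != 0 by rewrite sqrf_eq0.
  apply: (mulfI al2).
  have -> : al ^+ 2 * (d%:R * al * be ^+ 3) =
    d%:R * al * (al * be) * (al * be ^+ 2) by ring.
  by rewrite -e; ring.
have be0 : be != 0.
  apply/eqP=> be0; move: e.
  by rewrite be0 !expr0n /= mulr0 !addr0 => /eqP; rewrite oner_eq0.
(* [be * (d * al * be ^+ 2 - be - be ^+ 3) = 1], so that [be] is a unit. *)
have Iv : be^-1 \in Aint.
  have -> : be^-1 = d%:R * al * be ^+ 2 - be - be ^+ 3.
    apply: (mulfI be0); rewrite mulfV // -[LHS](addrK (be ^+ 2 + be ^+ 4)).
    by rewrite addrA e; ring.
  by rewrite !rpredB ?rpredM ?rpredX // rpred_nat.
have [b2|b2|b0] := imquad_unit_cases w0 w2 wc Kbe Ibe Iv be0; last first.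
- by move/esym/eqP: e; rewrite b0 !mulf_eq0 ?expf_eq0 (negPf al0) (negPf be0)
    (negPf dC0).
- right.
  have e1 : d%:R * (- (al * be)) = 1.
    have be4 : be ^+ 4 = 1 by rewrite -[4%N]/(2 * 2)%N exprM b2 sqrrN expr1n.
    move: e; rewrite be4 (exprS _ 2) b2 addrN add0r => e.
    by rewrite [RHS]e; ring.
  have d1 : d = 1%N.
    have Iy : - (al * be) \in Aint by rewrite rpredN rpredM.
    have ey : - (al * be) = d%:R^-1 by apply: (mulfI dC0); rewrite e1 mulfV.
    have Zy : d%:R^-1 \is a @Num.int algC.
      by rewrite Cint_rat_Aint ?rpredV ?rpred_nat // -ey.
    have := norm_intr_ge1 Zy (invr_neq0 dC0).
    rewrite ger0_norm ?invr_ge0 ?ler0n // invf_ge1 ?ltr0n // lern1.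
    by move: d0; case: (d) => [|[]].
  have -> : al = be.
    move: e1; rewrite d1 mul1r -[1]opprK -b2 => /oppr_inj.
    by rewrite expr2 => /(mulIf be0).
  by split; rewrite // ?b2 ?mulrN1 -?b2 ?expr2.
left.
have dal : d%:R * al = 3 * be.
  have be4 : be ^+ 4 = 1 by rewrite -[4%N]/(2 * 2)%N exprM b2 expr1n.
  move: e; rewrite be4 (exprS _ 2) b2 mulr1 => e; apply: (mulIf be0).
  by rewrite -e -mulrA -expr2 b2; ring.
have be1 : be = 1 \/ be = -1.
  by move/eqP: b2; rewrite sqrf_eq1 => /orP[]/eqP ->; [left|right].
have [eps [eb eps1]] : exists eps : int, be = eps%:~R /\ `|eps|%N = 1%N.
  by case: be1 => ->; [exists 1|exists (-1)]; rewrite ?mulrN1z.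
have [m em] : exists m : int, al = m%:~R.
  apply/intrP/Cint_rat_Aint => //.
  have -> : al = 3 * be / d%:R by rewrite -dal mulrC mulKf.
  by rewrite eb rpred_div ?rpred_nat // rpredM ?rpred_nat ?rpred_int.
have d13 : d \in pred2 1%N 3%N.
  have /primeP[_] : prime 3 by [].
  apply; apply/dvdnP; exists `|m|%N.
  have /eqP : (d%:Z * m)%:~R = (3 * eps)%:~R :> algC.
    by rewrite !rmorphM /= -em -eb dal.
  by rewrite eqr_int => /eqP /(congr1 absz); rewrite !abszM eps1 muln1 mulnC.
rewrite b2 mulr1 /rational_solutions.
case/pred2P: d13 dal => -> /=.
  rewrite mul1r => ->.
  by case: be1 => ->; [left|right]; rewrite /= ?mulr1 // mulrN1 mulrNN mulr1.
have n3 : 3 != 0 :> algC by rewrite pnatr_eq0.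
move/(mulfI n3) => ->.
by case: be1 => ->; [left|right]; rewrite /= ?mulr1 // mulrNN mulr1.
Qed.

Theorem theorem4p5 :
  (forall d D : nat, (0 < d)%N -> (0 < D)%N -> squarefree D ->
     (d, D) <> (1%N, 1%N) ->
     GP (Qsqrt_opp D) 1 1 1 d%:R = GP Q 1 1 1 d%:R /\
     GP Q 1 1 1 d%:R =
       (if d == 1%N then [set (3, 3, 3); (-3, 3, -3)]
        else if d == 3%N then [set (1, 1, 1); (-1, 1, -1)]
        else set0)) /\
  GP (Qadjoin [set 'i]) 1 1 1 1 =
    [set (3, 3, 3); (-3, 3, -3); ('i, -1, - 'i); (- 'i, -1, 'i)].
Proof.
split=> [d D d0 D0 sD dD|].
  have [w0 w2 wc] := sqrtC_opp D0.
  have w2Q : sqrtC (- D%:R) ^+ 2 \in Crat by rewrite w2 rpredN rpred_nat.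
  have KR : GP (Qsqrt_opp D) 1 1 1 d%:R `<=` rational_solutions d.
    move=> [[x y] z] /(GP_imquad w0 w2Q wc d0)[//|[d1 Kx x2 _ _]].
    by case: dD; rewrite d1 (sqrtN1_Qsqrt_opp D0 sD Kx x2).
  have RQ := @rational_solutions_subQ d.
  have QK := @GP_mono Q (Qsqrt_opp D) 1 1 1 d%:R (@subQ_Qadjoin _).
  (* Inclusions in a cycle: Q(sqrt(-D)), the explicit set, Q, Q(sqrt(-D)). *)
  split; apply/seteqP; split => //.
  - by move=> t /KR /RQ.
  - by move=> t /QK /KR.
have iQ : 'i ^+ 2 \in Crat by rewrite sqrCi rpredN rpred1.
apply/seteqP; split=> [[[x y] z]|].
  case/(GP_imquad (d := 1) (neq0Ci _) iQ (conjCi _) isT) => [h|[_ _ x2 -> ->]].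
    by left; left.
  have /eqP : x ^+ 2 = 'i ^+ 2 by rewrite sqrCi.
  rewrite eqf_sqr => /orP[]/eqP->; first by left; right.
  by right; rewrite /= opprK.
have Ki : Qadjoin [set 'i] 'i by apply: mem_Qadjoin.
move=> t [[h|->]|->].
- exact/(GP_mono (@subQ_Qadjoin _))/(@rational_solutions_subQ 1).
- by apply: GP_sqrtN1; rewrite ?sqrCi.
by have := GP_sqrtN1 (QadjoinN Ki); rewrite opprK sqrrN; apply; apply: sqrCi.
Qed.
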